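(* Let $Q$ be a finite (left) quasifield with $q$ elements. If $A,B,C\subset Q$, then \[ |A + B\cdot C| \geq q - \frac{q^3}{|A||B||C| + q^2}. \]
   Context: A (left) quasifield is a set $Q$ with two binary operations $+$ and $\cdot$ such that $(Q,+)$ is a group with identity $0$; $(Q\setminus\{0\},\cdot)$ is a loop (for all $a,b$ the equations $a\cdot x=b$ and $y\cdot a=b$ have unique solutions, and there is an identity $1$); $a\cdot(b+c)=a\cdot b+a\cdot c$ for all $a,b,c$; $0\cdot x=0$ for all $x$; and for $a\neq b$ the equation $a\cdot x=b\cdot x+c$ has exactly one solution $x$. $A+B\cdot C = \{a + b\cdot c : a\in A, b\in B, c\in C\}$. *)

(* Defs.v *)
From mathcomp Require Import all_boot.

Set Implicit Arguments.
Unset Strict Implicit.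
Unset Printing Implicit Defensive.

(* The group law is not assumed to be commutative, so zmodType is not used. *)
Record is_group (T : Type) (e : T) (op : T -> T -> T) : Prop := IsGroup {
  group_assoc : associative op;
  group_left_id : left_id e op;
  group_right_id : right_id e op;
  group_inverse : forall x, exists y, op y x = e /\ op x y = e
}.

(* [op] restricts to a loop on the subset [D] of [T]: equations are solved,
   and solutions are unique, inside [D]. *)
Record is_loop_on (T : Type) (D : T -> Prop) (e : T) (op : T -> T -> T) : Prop :=
  IsLoopOn {
  loop_closed : forall a b, D a -> D b -> D (op a b);
  loop_solve_right : forall a b, D a -> D b -> exists! x, D x /\ op a x = b;
  loop_solve_left : forall a b, D a -> D b -> exists! y, D y /\ op y a = b;
  loop_id_in : D e;
  loop_id : forall a, D a -> op e a = a /\ op a e = a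
}.

Record quasifield (Q : Type) : Type := Quasifield {
  qzero : Q;
  qone : Q;
  qadd : Q -> Q -> Q;
  qmul : Q -> Q -> Q;
  qadd_group : is_group qzero qadd;
  qmul_loop : is_loop_on (fun x => x <> qzero) qone qmul;
  qmul_addr : forall a b c, qmul a (qadd b c) = qadd (qmul a b) (qmul a c);
  qmul_0l : forall x, qmul qzero x = qzero;
  qmul_solve : forall a b c, a <> b ->
    exists! x, qmul a x = qadd (qmul b x) c
}.

Definition add_mul_set (Q : finType) (K : quasifield Q) (A B C : {set Q}) :
    {set Q} :=
  [set d | [exists a in A, exists b in B, exists c in C,
              d == qadd K a (qmul K b c)]].

(* Main.v *)
Require Import Defs.
From mathcomp Require Import all_boot all_order all_algebra.
From mathcomp Require Import ring.
Import Order.TTheory GRing.Theory Num.Theory.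
Local Open Scope ring_scope.

(** Regard pairs [(x, y)] as points and [y = a + b x] as lines. Put
    [S = A + B.C] and let [g] be the indicator function of [S] minus its mean.
    Two points with distinct abscissae lie on exactly one common line, so the
    functions [(a, b) |-> g (a + b x)] for distinct [x] are orthogonal, and the
    squares of [\sum_(x in C) g (a + b x)] add up, over all lines, to
    [|Q| |C| \sum_y g y ^+ 2]. On each of the [|A||B|] lines coming from [A] and
    [B] all the points with abscissa in [C] lie in [S], so the sum is
    [|C| (1 - |S| / |Q|)]; comparing gives the bound. *)

Lemma qadd_injl (Q : Type) (K : quasifield Q) (a : Q) : injective (qadd K a).
Proof.
have G := qadd_group K; have [a' [a'K _]] := group_inverse G a.
move=> x y /(congr1 (qadd K a')).
by rewrite !(group_assoc G) a'K !(group_left_id G).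
Qed.

Lemma qadd_injr (Q : Type) (K : quasifield Q) (a : Q) : injective (qadd K ^~ a).
Proof.
have G := qadd_group K; have [a' [_ aK]] := group_inverse G a.
move=> x y /(congr1 (qadd K ^~ a')) /=.
by rewrite -!(group_assoc G) aK !(group_right_id G).
Qed.

(** The loop axioms give uniqueness only among nonzero factors. A zero factor cannot be confused
    with a nonzero one: [qmul_0l] makes its product zero, and [loop_closed] keeps the other product
    nonzero. *)
Lemma qmul_injr (Q : eqType) (K : quasifield Q) (z : Q) :
  z <> qzero K -> injective (qmul K ^~ z).
Proof.
have L := qmul_loop K => z0.
have mul0 b : qmul K (qzero K) z = qmul K b z -> qzero K = b.
  move=> eq_bz; case: (eqVneq b (qzero K)) => [// | /eqP b0].
  by case: (loop_closed L b0 z0); rewrite -eq_bz qmul_0l.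
move=> b b' /= eq_bz.
have [b0|/eqP b0] := eqVneq b (qzero K).
  by move: eq_bz; rewrite b0; exact: mul0.
have [b'0|/eqP b'0] := eqVneq b' (qzero K).
  by move: eq_bz; rewrite b'0 => /esym/mul0/esym.
have [v [_ uniq_v]] := loop_solve_left L z0 (loop_closed L b0 z0).
by rewrite -(uniq_v b) // (uniq_v b').
Qed.

(** With [z = -x + x'], left distributivity gives [a + b x' = (a + b x) + b z]. The two values thus
    determine [b z], hence [b] as [z] is nonzero, and then [a]. *)
Lemma line_through_two_points (Q : eqType) (K : quasifield Q) (x x' : Q) :
  x != x' -> injective (fun ab : Q * Q =>
    (qadd K ab.1 (qmul K ab.2 x), qadd K ab.1 (qmul K ab.2 x'))).
Proof.
move=> /eqP neq_xx' [a b] [a' b'] /= [eq_x eq_x'].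
have G := qadd_group K.
have [z xz] : exists z, qadd K x z = x'.
  have [y [_ xy]] := group_inverse G x.
  by exists (qadd K y x'); rewrite (group_assoc G) xy (group_left_id G).
have z0 : z <> qzero K by move=> z0; case: neq_xx'; rewrite -xz z0 (group_right_id G).
have eq_b : b = b'.
  apply: (qmul_injr _ _ _ z0); move: eq_x'.
  rewrite -xz !qmul_addr !(group_assoc G) eq_x => eq_z.
  exact: qadd_injl eq_z.
by rewrite eq_b in eq_x *; rewrite (qadd_injr _ _ _ _ _ eq_x).
Qed.

Lemma sum_line_sqr (R : realFieldType) (Q : finType) (K : quasifield Q)
    (C : {set Q}) (g : Q -> R) :
  \sum_y g y = 0 ->
  \sum_(ab : Q * Q) (\sum_(x in C) g (qadd K ab.1 (qmul K ab.2 x))) ^+ 2 =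
  #|Q|%:R * #|C|%:R * \sum_y g y ^+ 2.
Proof.
move=> sum_g0.
under eq_bigr => ab _ do rewrite expr2 big_distrlr /=.
rewrite exchange_big /=.
rewrite -mulrA mulrCA mulr_natl -sumr_const; apply: eq_bigr => x xC.
rewrite exchange_big /= (bigD1 x) //= [X in _ + X]big1 ?addr0 => [|x' /andP[_ neq_x'x]].
  (* Diagonal terms: for fixed [b], the map [a |-> a + b x] permutes [Q]. *)
  transitivity (\sum_a \sum_b g (qadd K a (qmul K b x)) ^+ 2).
    by rewrite pair_bigA.
  rewrite exchange_big /= mulr_natl -sumr_const; apply: eq_bigr => b _.
  by rewrite [RHS](reindex_inj (qadd_injr _ K (qmul K b x))).
rewrite eq_sym in neq_x'x.
(* Off-diagonal terms: an injective self-map of the finite set [Q * Q] is a permutation, so the sum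
   becomes [(\sum_y g y) ^+ 2 = 0]. *)
transitivity (\sum_(p : Q * Q) g p.1 * g p.2).
  by rewrite [RHS](reindex_inj (line_through_two_points _ K _ _ neq_x'x)).
rewrite -(pair_bigA _ (fun y y' => g y * g y')) /=.
by rewrite -big_distrlr /= sum_g0 mul0r.
Qed.

(** The bound with its denominator cleared: with [p = |A||B||C|], one has
    [q - q^3 / (p + q^2) = p q / (p + q^2)]. *)
Lemma card_add_mul_set_ge (R : realFieldType) (Q : finType) (K : quasifield Q)
    (A B C : {set Q}) :
  #|A|%:R * #|B|%:R * #|C|%:R * #|Q|%:R <=
    #|add_mul_set K A B C|%:R * (#|A|%:R * #|B|%:R * #|C|%:R + #|Q|%:R ^+ 2) :> R.
Proof.
set S := add_mul_set K A B C.
set a : R := #|A|%:R; set b : R := #|B|%:R; set c : R := #|C|%:R.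
set q : R := #|Q|%:R; set s : R := #|S|%:R.
have q_gt0 : 0 < q by rewrite ltr0n; apply/card_gt0P; exists (qzero K).
have s_le_q : s <= q by rewrite ler_nat max_card.
have [a0 b0 s0] : [/\ 0 <= a, 0 <= b & 0 <= s] by split; exact: ler0n.
have ind : \sum_(y : Q) (y \in S)%:R = s by rewrite -natr_sum -big_mkcond sum1_card.
pose m := s / q; pose g (y : Q) : R := (y \in S)%:R - m.
have mq : m * q = s by rewrite divfK ?gt_eqF.
have sum_m u : \sum_(y : Q) u = u * q by rewrite sumr_const mulr_natr.
have sum_g : \sum_y g y = 0 by rewrite sumrB ind sum_m mq subrr.
have sum_g2 : \sum_y g y ^+ 2 = s * (1 - m).
  (* The indicator of [S] equals its own square, so [g y ^+ 2] is affine in it. *)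
  transitivity (\sum_(y : Q) ((1 - 2 * m) * (y \in S)%:R + m * m)).
    by apply: eq_bigr => y _; rewrite /g; case: (y \in S) => /=; ring.
  by rewrite big_split /= -mulr_sumr ind sum_m -mulrA mq; ring.
have AB_le : a * b * (c * (1 - m)) ^+ 2 <= q * c * (s * (1 - m)).
  rewrite -sum_g2 -(sum_line_sqr _ _ K _ _ sum_g).
  rewrite [leRHS](bigID (mem (setX A B))) /= -[leLHS]addr0.
  apply: lerD; last by apply: sumr_ge0 => ab _; rewrite sqr_ge0.
  rewrite -natrM -cardsX mulr_natl -sumr_const le_eqVlt; apply/orP; left.
  apply/eqP/eq_bigr => -[x y]; rewrite inE /= => /andP[xA yB]; congr (_ ^+ 2).
  rewrite mulr_natl -sumr_const; apply: eq_bigr => z zC.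
  suff Sxyz : qadd K x (qmul K y z) \in S by rewrite /g Sxyz.
  rewrite inE; apply/exists_inP; exists x => //; apply/exists_inP; exists y => //.
  by apply/exists_inP; exists z.
(* [AB_le] is to be divided by [c * (1 - m)]; the cases [c = 0] and [s = q], where this factor
   vanishes, are settled first. *)
have [->|c_neq0] := eqVneq c 0.
  by rewrite !(mulr0, mul0r) mulr_ge0 // add0r exprn_ge0 // ltW.
have c_gt0 : 0 < c by rewrite lt_def c_neq0 ler0n.
have abc_ge0 : 0 <= a * b * c by rewrite !mulr_ge0 // ltW.
have [s_lt_q|q_le_s] := ltP s q; last first.
  have -> : s = q by apply/le_anti; rewrite s_le_q.
  by rewrite mulrDr [q * _]mulrC lerDl mulr_ge0 ?exprn_ge0 ?ltW.
have m_lt1 : 0 < 1 - m by rewrite subr_gt0 ltr_pdivrMr // mul1r.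
have : a * b * c * (1 - m) <= q * s.
  rewrite -(ler_pM2r (mulr_gt0 c_gt0 m_lt1)).
  by apply: le_trans (le_trans AB_le _); rewrite le_eqVlt; apply/orP; left; apply/eqP; ring.
(* Multiplying by [q] turns [1 - m] into [q - s]; the rest is rearrangement. *)
rewrite -(ler_pM2r q_gt0).
have -> : a * b * c * (1 - m) * q = a * b * c * (q - s) by rewrite -mq; ring.
move=> abc_le.
by rewrite mulrDr -subr_ge0; move: abc_le; rewrite -subr_ge0; congr (0 <= _); ring.
Qed.

Theorem theorem1p8 (R : realFieldType) (Q : finType) (K : quasifield Q)
    (A B C : {set Q}) :
  (#|Q|%:R : R) - (#|Q|%:R : R) ^+ 3 /
      ((#|A|%:R : R) * (#|B|%:R : R) * (#|C|%:R : R) + (#|Q|%:R : R) ^+ 2)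
    <= (#|add_mul_set K A B C|%:R : R).
Proof.
have := card_add_mul_set_ge R Q K A B C.
set s := #|add_mul_set _ _ _ _|%:R; set q := #|Q|%:R.
set p := _ * _ * #|C|%:R => ge_s.
have q_gt0 : 0 < q by rewrite ltr0n; apply/card_gt0P; exists (qzero K).
have pq_gt0 : 0 < p + q ^+ 2 by rewrite ltr_wpDl ?exprn_gt0 // !mulr_ge0 ?ler0n.
rewrite -(ler_pM2r pq_gt0) mulrBl divfK ?gt_eqF //.
by apply: le_trans ge_s; rewrite le_eqVlt; apply/orP; left; apply/eqP; ring.
Qed.
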